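(* Let $M(\mathbb{R}^n)$ denote the set of Gaussian mixture distributions on $\mathbb{R}^n$, and let $d$ be the function on $M(\mathbb{R}^n)\times M(\mathbb{R}^n)$ defined in the context below. Then $d$ is a metric on $M(\mathbb{R}^n)$: for all $\mu_0,\mu_1,\mu_2\in M(\mathbb{R}^n)$ we have $d(\mu_0,\mu_1)\ge 0$, $d(\mu_0,\mu_1)=0$ if and only if $\mu_0=\mu_1$, $d(\mu_0,\mu_1)=d(\mu_1,\mu_0)$, and $d(\mu_0,\mu_2)\le d(\mu_0,\mu_1)+d(\mu_1,\mu_2)$.
   Context: A Gaussian distribution on $\mathbb{R}^n$ is the normal law $N(m,\Sigma)$ with mean $m\in\mathbb{R}^n$ and symmetric positive definite covariance $\Sigma$. For two Gaussians $\nu_0=N(m_0,\Sigma_0)$, $\nu_1=N(m_1,\Sigma_1)$, $W_2(\nu_0,\nu_1)$ denotes their 2-Wasserstein distance (quadratic-cost optimal transport distance), which equals $W_2(\nu_0,\nu_1)^2=\|m_0-m_1\|^2+\operatorname{trace}\big(\Sigma_0+\Sigma_1-2(\Sigma_0^{1/2}\Sigma_1\Sigma_0^{1/2})^{1/2}\big)$. A Gaussian mixture distribution is a probability distribution of the form $\mu=\sum_{k=1}^N p^k\nu^k$ with $N$ finite, each $\nu^k$ a Gaussian distribution on $\mathbb{R}^n$, and $p=(p^1,\dots,p^N)$ a probability vector; $M(\mathbb{R}^n)$ is the set of these. Given $\mu_0=\sum_{i=1}^{N_0}p_0^i\nu_0^i$ and $\mu_1=\sum_{j=1}^{N_1}p_1^j\nu_1^j$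 in $M(\mathbb{R}^n)$, let $\Pi(p_0,p_1)$ be the set of nonnegative $N_0\times N_1$ matrices $\pi$ with $\sum_j\pi(i,j)=p_0^i$ and $\sum_i\pi(i,j)=p_1^j$, set $c(i,j)=W_2(\nu_0^i,\nu_1^j)^2$, let $\pi^*$ be a minimizer of $\sum_{i,j}c(i,j)\pi(i,j)$ over $\pi\in\Pi(p_0,p_1)$, and define $d(\mu_0,\mu_1)=\sqrt{\sum_{i,j}c(i,j)\pi^*(i,j)}$. *)

(* Defs.v *)
From HB Require Import structures.
From mathcomp Require Import all_boot all_order all_algebra.
From mathcomp Require Import all_classical all_reals all_analysis.
Set Implicit Arguments. Unset Strict Implicit. Unset Printing Implicit Defensive.
Import Order.TTheory GRing.Theory Num.Theory.
Local Open Scope ring_scope.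

Definition sym_mx (R : realType) (n : nat) (A : 'M[R]_n) : Prop := A^T = A.

Definition psd_mx (R : realType) (n : nat) (A : 'M[R]_n) : Prop :=
  sym_mx A /\ forall v : 'rV[R]_n, 0 <= (v *m A *m v^T) 0 0.

Definition pd_mx (R : realType) (n : nat) (A : 'M[R]_n) : Prop :=
  sym_mx A /\ forall v : 'rV[R]_n, v != 0 -> 0 < (v *m A *m v^T) 0 0.

Definition sqrtmx (R : realType) (n : nat) (A : 'M[R]_n) : 'M[R]_n :=
  xget 0 [set S : 'M[R]_n | psd_mx S /\ S *m S = A].

Record gaussian (R : realType) (n : nat) := Gauss {
  gmean : 'rV[R]_n;
  gcov  : 'M[R]_n }.

(* A Gaussian mixture sum_{k < N} p^k nu^k, given by a representation *)
Record gmm (R : realType) (n : nat) := GMM {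
  gN : nat;
  gw : 'I_gN -> R;
  gcomp : 'I_gN -> gaussian R n }.
Arguments gN {R n} _.
Arguments gw {R n} _ _.
Arguments gcomp {R n} _ _.
Arguments gmean {R n} _.
Arguments gcov {R n} _.

Definition is_gmm (R : realType) (n : nat) (mu : gmm R n) : Prop :=
  [/\ forall k, 0 <= gw mu k,
      \sum_k gw mu k = 1
    & forall k, pd_mx (gcov (gcomp mu k))].

Definition gauss_density (R : realType) (n : nat) (g : gaussian R n)
    (x : 'rV[R]_n) : R :=
  expR (- ((x - gmean g) *m invmx (gcov g) *m (x - gmean g)^T) 0 0 / 2)
  / Num.sqrt ((2 * pi) ^+ n * \det (gcov g)).

(* Lebesgue density of the mixture; two mixtures are the same probability
   distribution iff these (continuous) densities coincide *)
Definition mixture_density (R : realType) (n : nat) (mu : gmm R n)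
    (x : 'rV[R]_n) : R :=
  \sum_k gw mu k * gauss_density (gcomp mu k) x.

(* squared 2-Wasserstein distance between Gaussians (closed form) *)
Definition W2sq (R : realType) (n : nat) (g0 g1 : gaussian R n) : R :=
  \sum_i (gmean g0 0 i - gmean g1 0 i) ^+ 2
  + \tr (gcov g0 + gcov g1
         - 2%:R *: sqrtmx (sqrtmx (gcov g0) *m gcov g1 *m sqrtmx (gcov g0))).

Definition coupling (R : realType) (n : nat) (mu0 mu1 : gmm R n)
    (P : 'M[R]_(gN mu0, gN mu1)) : Prop :=
  [/\ forall i j, 0 <= P i j,
      forall i, \sum_j P i j = gw mu0 i
    & forall j, \sum_i P i j = gw mu1 j].

Definition coupling_cost (R : realType) (n : nat) (mu0 mu1 : gmm R n)
    (P : 'M[R]_(gN mu0, gN mu1)) : R :=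
  \sum_i \sum_j W2sq (gcomp mu0 i) (gcomp mu1 j) * P i j.

(* d(mu0, mu1) = sqrt of the optimal (minimal) discrete transport cost;
   the minimum is attained, so it equals the infimum *)
Definition gmm_dist (R : realType) (n : nat) (mu0 mu1 : gmm R n) : R :=
  Num.sqrt (inf [set c : R | exists P : 'M[R]_(gN mu0, gN mu1), coupling P /\ c = coupling_cost P]).

(* Main.v *)
Require Import Defs.
From HB Require Import structures.
From mathcomp Require Import all_boot all_order all_algebra.
From mathcomp Require Import all_classical all_reals all_analysis.
From mathcomp Require Import complex ring lra.
Set Implicit Arguments. Unset Strict Implicit. Unset Printing Implicit Defensive.
Import Order.TTheory GRing.Theory Num.Theory.
Local Open Scope ring_scope.

(**
The covariance part of [W2sq] is the Procrustes distance
[min |X - Y|_F^2] over factorisations [X X^T = A] and [Y Y^T = B], and the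
minimum is reached with [X] prescribed.  Hence [W2sq] is symmetric, vanishes
only on equal Gaussians, and satisfies
[W2sq g k <= (1 + s) W2sq g h + (1 + 1/s) W2sq h k] for all [s > 0], which
encodes the triangle inequality for its square root.  This form is linear in
the costs, so it passes to glued couplings and then to the infimum, and
optimising over [s] gives the triangle inequality for the distance.

If the distance is [0], the densities agree because their difference at a
point is at most a constant times the cost of any coupling.  Conversely,
distinct Gaussian densities are linearly independent: along a generic line
through the origin they become multiples of [exp (a t^2 + b t)] with distinct
[(a, b)], and the lexicographically largest pair dominates as [t] grows.
Equal densities thus give every Gaussian the same total weight in both
mixtures, and some coupling moves no mass between different components.
*)

(** * Positive semidefinite square roots *)

(** Newton interpolation: a multiple of the polynomial vanishing at the earlier nodes corrects the
    value at the new one. It serves to realise functions of a matrix as polynomials in it. *)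
Lemma poly_interpolation (F : fieldType) (s : seq F) (f : F -> F) :
  exists p : {poly F}, {in s, forall x, p.[x] = f x}.
Proof.
elim: s => [|a s [p ps]]; first by exists 0.
have [as_|ans] := boolP (a \in s).
  by exists p => x; rewrite inE => /predU1P[->|]; exact: ps.
pose q := \prod_(x <- s) ('X - x%:P).
have qs x : (q.[x] == 0) = (x \in s) by rewrite -root_prod_XsubC.
exists (p + ((f a - p.[a]) / q.[a]) *: q) => x; rewrite inE !hornerE.
have [->|xa] /= := eqVneq x a.
  by move=> _; rewrite divfK ?qs// addrC subrK.
by move=> xs; move: (xs); rewrite -qs => /eqP ->; rewrite mulr0 addr0 ps.
Qed.

Lemma row_sqnorm (R : realType) (n : nat) (v : 'rV[R]_n) :
  (v *m v^T) 0 0 = \sum_i v 0 i ^+ 2.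
Proof. by rewrite mxE; apply: eq_bigr => i _; rewrite mxE expr2. Qed.

Lemma row_sqnorm_ge0 (R : realType) (n : nat) (v : 'rV[R]_n) :
  0 <= (v *m v^T) 0 0.
Proof. by rewrite row_sqnorm sumr_ge0 // => i _; exact: sqr_ge0. Qed.

Lemma row_sqnorm_gt0 (R : realType) (n : nat) (v : 'rV[R]_n) :
  v != 0 -> 0 < (v *m v^T) 0 0.
Proof.
move=> v0; rewrite lt_neqAle row_sqnorm_ge0 andbT eq_sym; apply: contraNN v0.
rewrite row_sqnorm psumr_eq0 => [/allP v0|i _]; last exact: sqr_ge0.
apply/eqP/rowP => i; rewrite mxE; apply/eqP.
by move: (v0 i); rewrite mem_index_enum sqrf_eq0; apply.
Qed.

Lemma psd_eigenvalue_ge0 (R : realType) (n : nat) (A : 'M[R]_n) (a : R) :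
  psd_mx A -> eigenvalue A a -> 0 <= a.
Proof.
move=> [_ A0] /eigenvalueP[v vA v0]; have := A0 v.
by rewrite vA -scalemxAl mxE pmulr_lge0 // row_sqnorm_gt0.
Qed.


Lemma trmx_horner_mx (R : comNzRingType) (n : nat) (A : 'M[R]_n.+1)
    (p : {poly R}) : (horner_mx A p)^T = horner_mx A^T p.
Proof.
elim/poly_ind: p => [|p c IH]; first by rewrite !rmorph0 trmx0.
rewrite mulrC !rmorphD !rmorphM /= !horner_mx_X !horner_mx_C linearD /=.
rewrite trmx_mul IH tr_scalar_mx; congr (_ + _).
(* Transposition has reversed the product; both factors are values of the morphism [horner_mx A^T],
   so they commute. *)
rewrite -[X in _ *m X]horner_mx_X -[X in _ = X * _]horner_mx_X.
by rewrite -[LHS]rmorphM -[RHS]rmorphM mulrC.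
Qed.

(** Two fields appear because a real matrix will be diagonalised over the complex numbers. There [q]
    of the matrix is conjugate to [q] of the diagonal, and extension of scalars is injective. *)
Lemma horner_mx_diagonalizable_eq0 (F K : fieldType) (f : {rmorphism F -> K})
    (n : nat) (A : 'M[F]_n.+1) (P : 'M[K]_n.+1) (d : 'rV[K]_n.+1)
    (e : 'I_n.+1 -> F) (q : {poly F}) :
  P \in unitmx -> map_mx f A = invmx P *m diag_mx d *m P ->
  (forall i, d 0 i = f (e i)) -> (forall i, q.[e i] = 0) -> horner_mx A q = 0.
Proof.
move=> Pu AE de qe; apply/eqP; rewrite -(map_mx_eq0 f); apply/eqP.
rewrite map_horner_mx AE horner_mx_uconjC // horner_mx_diag.
suff -> : map_mx (horner (map_poly f q)) d = 0 by rewrite linear0 mulmx0 mul0mx.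
by apply/rowP => i; rewrite !mxE de horner_map qe rmorph0.
Qed.

Lemma eigenvalue_similar_diag (F : fieldType) (n : nat) (A P : 'M[F]_n)
    (d : 'rV[F]_n) (i : 'I_n) :
  P \in unitmx -> A = invmx P *m diag_mx d *m P -> eigenvalue A (d 0 i).
Proof.
move=> Pu AE; apply/eigenvalueP; exists (row i P).
  have PA : P *m A = diag_mx d *m P by rewrite AE !mulmxA mulmxV // mul1mx.
  by rewrite -row_mul PA; apply/rowP => j; rewrite mul_diag_mx !mxE.
apply/negP => /eqP/(congr1 (mulmx^~ (invmx P))).
rewrite rowE mulmxK // mul0mx => /rowP/(_ i)/eqP.
by rewrite !mxE !eqxx oner_eq0.
Qed.

(** The list [s] is the spectrum: the complexified matrix is Hermitian, hence unitarily
    diagonalisable with real eigenvalues, which are also eigenvalues of [A] and so nonnegative. *)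
Lemma horner_mx_psd_eq0 (R : realType) (n : nat) (A : 'M[R]_n.+1) :
  psd_mx A -> exists2 s : seq R, all (fun x => 0 <= x) s &
    forall q : {poly R}, {in s, forall x, q.[x] = 0} -> horner_mx A q = 0.
Proof.
move=> Apsd; pose f := real_complex R; pose AC := map_mx f A.
have Aherm : AC \is hermsymmx.
  apply: realsym_hermsym.
    by apply/is_hermitianmxP; rewrite expr0 scale1r map_mx_id // /AC map_trmx Apsd.1.
  by apply/mxOverP => i j; rewrite mxE complex_real.
have /mxOverP dreal := hermitian_spectral_diag_real Aherm.
have /hermitian_normalmx/orthomx_spectralP := Aherm.
set P := spectralmx AC; set d := spectral_diag AC in dreal * => AE.
have Pu : P \in unitmx by exact: spectral_unit.
clearbody P d.
pose e i := complex.Re (d 0 i).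
have eE i : d 0 i = f (e i) by rewrite /e /f RRe_real // dreal.
exists [seq e i | i <- enum 'I_n.+1].
  apply/allP => _ /mapP[i _ ->]; apply: (@psd_eigenvalue_ge0 _ _ A) => //.
  suff: eigenvalue AC (d 0 i) by rewrite eE eigenvalue_map.
  exact: eigenvalue_similar_diag AE.
move=> q qs; apply: (@horner_mx_diagonalizable_eq0 _ _ f _ A P d e) => // i.
by apply: qs; apply/mapP; exists i; rewrite ?mem_enum.
Qed.

(* A fourth root [T] makes the square root [T T^T] visibly psd. *)
Lemma psd_fourth_root (R : realType) (n : nat) (A : 'M[R]_n) :
  psd_mx A -> exists2 T : 'M[R]_n, T^T = T & T *m T *m (T *m T) = A.
Proof.
case: n A => [A _|n A Apsd]; first by exists 0; apply/matrixP => -[].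
have [s s0 sA] := @horner_mx_psd_eq0 _ _ _ Apsd.
(* As [p] is the fourth root on the spectrum, [p ^+ 4 - 'X] vanishes there and annihilates [A]. *)
have [p ps] := @poly_interpolation _ s (fun x => Num.sqrt (Num.sqrt x)).
exists (horner_mx A p); first by rewrite trmx_horner_mx Apsd.1.
apply/eqP; rewrite -subr_eq0 !mulmxE -!rmorphM -{2}[A]horner_mx_X -rmorphB.
apply/eqP/sA => x xs; rewrite hornerD hornerN hornerX !hornerM ps //.
set y := Num.sqrt (Num.sqrt x); transitivity ((y ^+ 2) ^+ 2 - x); first by ring.
by rewrite !sqr_sqrtr ?subrr ?sqrtr_ge0 // (allP s0).
Qed.

Lemma sqrtmxP (R : realType) (n : nat) (A : 'M[R]_n) :
  psd_mx A -> psd_mx (sqrtmx A) /\ sqrtmx A *m sqrtmx A = A.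
Proof.
move=> /psd_fourth_root[T Ts TA].
suff: [set S : 'M[R]_n | psd_mx S /\ S *m S = A]%classic (sqrtmx A) by [].
apply: (@xgetPex _ 0); exists (T *m T); split => //; split.
  by rewrite /sym_mx trmx_mul Ts.
by move=> v; rewrite mulmxA -{2}Ts -mulmxA -trmx_mul row_sqnorm_ge0.
Qed.

(** * The Wasserstein distance between Gaussians *)

Lemma pd_psd (R : realType) (n : nat) (A : 'M[R]_n) : pd_mx A -> psd_mx A.
Proof.
move=> [As A0]; split => // v; have [->|/A0/ltW//] := eqVneq v 0.
by rewrite !mul0mx mxE.
Qed.

Lemma pd_unit (R : realType) (n : nat) (A : 'M[R]_n) :
  pd_mx A -> A \in unitmx.
Proof.
move=> [_ A0]; rewrite -row_free_unit; apply/inj_row_free => v vA.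
by apply/eqP/negPn/negP => /A0; rewrite vA mul0mx mxE ltxx.
Qed.

Lemma psd_congr (R : realType) (n : nat) (A S : 'M[R]_n) :
  psd_mx A -> psd_mx (S *m A *m S^T).
Proof.
move=> [As A0]; split; first by rewrite /sym_mx !trmx_mul trmxK As mulmxA.
move=> v; have -> : v *m (S *m A *m S^T) *m v^T = v *m S *m A *m (v *m S)^T.
  by rewrite trmx_mul !mulmxA.
exact: A0.
Qed.

(** * Squared Frobenius norm and the Procrustes form of the covariance term *)

Definition frob2 (R : realType) (m n : nat) (X : 'M[R]_(m, n)) : R :=
  \sum_i \sum_j X i j ^+ 2.

Lemma frob2E (R : realType) (m n : nat) (X : 'M[R]_(m, n)) :
  frob2 X = \tr (X *m X^T).
Proof.
rewrite /frob2 /mxtrace; apply: eq_bigr => i _; rewrite mxE.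
by apply: eq_bigr => j _; rewrite mxE expr2.
Qed.

Lemma frob2_ge0 (R : realType) (m n : nat) (X : 'M[R]_(m, n)) : 0 <= frob2 X.
Proof.
by apply: sumr_ge0 => i _; apply: sumr_ge0 => j _; exact: sqr_ge0.
Qed.

Lemma frob2_eq0 (R : realType) (m n : nat) (X : 'M[R]_(m, n)) :
  frob2 X = 0 -> X = 0.
Proof.
move=> X0; apply/matrixP => i j; rewrite mxE; apply/eqP; rewrite -sqrf_eq0.
have r0 k : 0 <= \sum_l X k l ^+ 2 by apply: sumr_ge0 => l _; exact: sqr_ge0.
have /eqP := X0; rewrite /frob2 psumr_eq0 // => /allP/(_ i).
rewrite mem_index_enum => /(_ isT); rewrite psumr_eq0 => [/allP/(_ j)|k _].
  by rewrite mem_index_enum; apply.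
exact: sqr_ge0.
Qed.

Lemma frob2N (R : realType) (m n : nat) (X : 'M[R]_(m, n)) :
  frob2 (- X) = frob2 X.
Proof.
by apply: eq_bigr => i _; apply: eq_bigr => j _; rewrite mxE sqrrN.
Qed.

Lemma frob2_sub (R : realType) (m n : nat) (X Y : 'M[R]_(m, n)) :
  frob2 (X - Y) = \tr (X *m X^T) + \tr (Y *m Y^T) - 2 * \tr (X *m Y^T).
Proof.
rewrite frob2E [(X - Y)^T]linearB /= mulmxBl !mulmxBr !raddfB /=.
have -> : \tr (Y *m X^T) = \tr (X *m Y^T).
  by rewrite -mxtrace_tr trmx_mul trmxK.
ring.
Qed.

(* Optimising over [s] recovers [|x - z| <= |x - y| + |y - z|]. *)
Lemma sqr_sub_young (R : realFieldType) (s x y z : R) : 0 < s ->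
  (x - z) ^+ 2 <= (1 + s) * (x - y) ^+ 2 + (1 + s^-1) * (y - z) ^+ 2.
Proof.
move=> s0; rewrite -subr_ge0.
have -> : (1 + s) * (x - y) ^+ 2 + (1 + s^-1) * (y - z) ^+ 2 - (x - z) ^+ 2 =
  s^-1 * (s * (x - y) - (y - z)) ^+ 2 by field; rewrite gt_eqF.
by rewrite mulr_ge0 ?sqr_ge0 // invr_ge0 ltW.
Qed.

Lemma frob2_young (R : realType) (m n : nat) (s : R) (X Y Z : 'M[R]_(m, n)) :
  0 < s ->
  frob2 (X - Z) <= (1 + s) * frob2 (X - Y) + (1 + s^-1) * frob2 (Y - Z).
Proof.
move=> s0; rewrite /frob2 !mulr_sumr -big_split ler_sum // => i _ /=.
rewrite !mulr_sumr -big_split ler_sum // => j _ /=.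
by rewrite !mxE sqr_sub_young.
Qed.

(** With [N] the square root of [M], the nonnegative number [frob2 (N - N *m Q^T)] expands to
    [2 * \tr M - 2 * \tr (M *m Q)]. *)
Lemma mxtrace_psd_orth (R : realType) (n : nat) (M Q : 'M[R]_n) :
  psd_mx M -> Q *m Q^T = 1%:M -> \tr (M *m Q) <= \tr M.
Proof.
move=> /sqrtmxP[]; set N := sqrtmx M => -[Ns _] NM QQ.
have := frob2_ge0 (N - N *m Q^T).
rewrite frob2_sub !trmx_mul !trmxK Ns NM -mulmxA (mulmxA Q^T) (mulmx1C QQ).
rewrite mul1mx NM mulmxA mxtrace_mulC mulmxA NM; lra.
Qed.

(** The squared Bures distance. *)
Definition bures (R : realType) (n : nat) (A B : 'M[R]_n) : R :=
  \tr (A + B - 2%:R *: sqrtmx (sqrtmx A *m B *m sqrtmx A)).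

Lemma buresE (R : realType) (n : nat) (A B : 'M[R]_n) : pd_mx A -> pd_mx B ->
  exists S M : 'M[R]_n,
  [/\ S^T = S /\ S \in unitmx, S *m S = A, psd_mx M /\ M \in unitmx,
      M *m M = S *m B *m S
    & bures A B = \tr A + \tr B - 2 * \tr M].
Proof.
move=> Apd Bpd; have [[Ss S0] SA] := sqrtmxP (pd_psd Apd).
have [] := @sqrtmxP _ _ (sqrtmx A *m B *m sqrtmx A).
  by rewrite -{2}Ss; exact/psd_congr/pd_psd.
set S := sqrtmx A in Ss S0 SA *; set M := sqrtmx _ => Mpsd MM.
have Su : S \in unitmx.
  by have := pd_unit Apd; rewrite -SA unitmx_mul => /andP[].
exists S, M; split => //.
  split => //; have : M *m M \in unitmx.
    by rewrite MM !unitmx_mul Su (pd_unit Bpd).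
  by rewrite unitmx_mul => /andP[].
by rewrite /bures raddfB raddfD /= linearZ.
Qed.

(** All factorisations have the form [X = S *m U] and [Y = invmx S *m M *m V] with [U] and [V]
    orthogonal. By cyclicity [\tr (X *m Y^T) = \tr (M *m (U *m V^T))], which is at most [\tr M]. *)
Lemma bures_le (R : realType) (n : nat) (A B X Y : 'M[R]_n) :
  pd_mx A -> pd_mx B -> X *m X^T = A -> Y *m Y^T = B ->
  bures A B <= frob2 (X - Y).
Proof.
move=> Apd Bpd XA YB.
have [S [M [[Ss Su] SA [Mpsd Mu] MM ->]]] := buresE Apd Bpd.
rewrite frob2_sub XA YB lerD2l lerN2 ler_pM2l //.
pose U := invmx S *m X; pose V := invmx M *m S *m Y.
have XE : X = S *m U by rewrite mulKVmx.
have YE : Y = invmx S *m M *m V by rewrite /V -!mulmxA mulKVmx // mulKmx.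
have Ms := Mpsd.1.
have UU : U *m U^T = 1%:M.
  rewrite trmx_mul trmx_inv Ss mulmxA -(mulmxA _ X) XA -SA.
  by rewrite mulmxA mulVmx // mul1mx mulmxV.
have VV : V *m V^T = 1%:M.
  rewrite !trmx_mul trmx_inv Ss Ms !mulmxA -(mulmxA _ Y) YB.
  rewrite -(mulmxA (invmx M)) -(mulmxA (invmx M)) -MM mulmxA.
  by rewrite mulVmx // mul1mx mulmxV.
clearbody U V; rewrite XE YE !trmx_mul trmx_inv Ss Ms -mulmxA mxtrace_mulC.
rewrite -!mulmxA mulVmx // mulmx1 mulmxA mxtrace_mulC mxtrace_psd_orth //.
by rewrite trmx_mul trmxK mulmxA -(mulmxA U) (mulmx1C VV) mulmx1.
Qed.

(** Equality in the previous bound occurs for [V = U]. Since [X] is arbitrary, optimal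
    factorisations can be chained. *)
Lemma bures_attained (R : realType) (n : nat) (A B X : 'M[R]_n) :
  pd_mx A -> pd_mx B -> X *m X^T = A ->
  exists2 Y, Y *m Y^T = B & bures A B = frob2 (X - Y).
Proof.
move=> Apd Bpd XA.
have [S [M [[Ss Su] SA [Mpsd Mu] MM ->]]] := buresE Apd Bpd.
pose U := invmx S *m X.
have XE : X = S *m U by rewrite mulKVmx.
have Ms := Mpsd.1.
have UU : U *m U^T = 1%:M.
  rewrite trmx_mul trmx_inv Ss mulmxA -(mulmxA _ X) XA -SA.
  by rewrite mulmxA mulVmx // mul1mx mulmxV.
clearbody U.
have YB : (invmx S *m M *m U) *m (invmx S *m M *m U)^T = B.
  rewrite !trmx_mul trmx_inv Ss Ms !mulmxA -(mulmxA _ U) UU mulmx1.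
  by rewrite -(mulmxA _ M M) MM !mulmxA mulVmx // mul1mx mulmxK.
exists (invmx S *m M *m U) => //; rewrite frob2_sub XA YB XE; congr (_ - 2 * _).
rewrite !trmx_mul trmx_inv Ss Ms !mulmxA -(mulmxA _ U) UU mulmx1.
by rewrite mxtrace_mulC mulmxA mulVmx // mul1mx.
Qed.

Lemma pd_factor (R : realType) (n : nat) (A : 'M[R]_n) : pd_mx A ->
  exists X : 'M[R]_n, X *m X^T = A.
Proof.
by move=> /pd_psd/sqrtmxP[[Ss _] SA]; exists (sqrtmx A); rewrite Ss.
Qed.

Lemma bures_ge0 (R : realType) (n : nat) (A B : 'M[R]_n) :
  pd_mx A -> pd_mx B -> 0 <= bures A B.
Proof.
move=> Apd Bpd; have [X XA] := pd_factor Apd.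
by have [Y _ ->] := bures_attained Apd Bpd XA; exact: frob2_ge0.
Qed.

Lemma bures_refl (R : realType) (n : nat) (A : 'M[R]_n) :
  pd_mx A -> bures A A = 0.
Proof.
move=> Apd; have [X XA] := pd_factor Apd; apply/eqP.
rewrite eq_le bures_ge0 // andbT (le_trans (bures_le Apd Apd XA XA)) //.
by rewrite subrr frob2E mul0mx mxtrace0.
Qed.

Lemma bures_eq0 (R : realType) (n : nat) (A B : 'M[R]_n) :
  pd_mx A -> pd_mx B -> bures A B = 0 -> A = B.
Proof.
move=> Apd Bpd; have [X XA] := pd_factor Apd.
have [Y YB ->] := bures_attained Apd Bpd XA.
by move=> /frob2_eq0/subr0_eq XY; rewrite -XA XY YB.
Qed.

Lemma bures_sym_le (R : realType) (n : nat) (A B : 'M[R]_n) :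
  pd_mx A -> pd_mx B -> bures A B <= bures B A.
Proof.
move=> Apd Bpd; have [Y YB] := pd_factor Bpd.
have [X XA ->] := bures_attained Bpd Apd YB.
by rewrite -frob2N opprB bures_le.
Qed.

(** Choose [Y] optimal for [X], then [Z] optimal for that same [Y]; the pair [X], [Z] is a
    competitor for [A] and [C]. *)
Lemma bures_young (R : realType) (n : nat) (s : R) (A B C : 'M[R]_n) :
  pd_mx A -> pd_mx B -> pd_mx C -> 0 < s ->
  bures A C <= (1 + s) * bures A B + (1 + s^-1) * bures B C.
Proof.
move=> Apd Bpd Cpd s0; have [X XA] := pd_factor Apd.
have [Y YB ->] := bures_attained Apd Bpd XA.
have [Z ZC ->] := bures_attained Bpd Cpd YB.
by rewrite (le_trans (bures_le Apd Cpd XA ZC)) // frob2_young.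
Qed.

Lemma W2sqE (R : realType) (n : nat) (g h : gaussian R n) :
  W2sq g h = frob2 (gmean g - gmean h) + bures (gcov g) (gcov h).
Proof.
rewrite /W2sq /frob2 big_ord1; congr (_ + _).
by apply: eq_bigr => i _; rewrite !mxE.
Qed.

Lemma W2sq_ge0 (R : realType) (n : nat) (g h : gaussian R n) :
  pd_mx (gcov g) -> pd_mx (gcov h) -> 0 <= W2sq g h.
Proof. by move=> gpd hpd; rewrite W2sqE addr_ge0 ?frob2_ge0 ?bures_ge0. Qed.

Lemma W2sq_refl (R : realType) (n : nat) (g : gaussian R n) :
  pd_mx (gcov g) -> W2sq g g = 0.
Proof.
by move=> gpd; rewrite W2sqE subrr bures_refl // frob2E mul0mx mxtrace0 addr0.
Qed.

Lemma W2sq_eq0 (R : realType) (n : nat) (g h : gaussian R n) :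
  pd_mx (gcov g) -> pd_mx (gcov h) -> W2sq g h = 0 -> g = h.
Proof.
move=> gpd hpd /eqP; rewrite W2sqE paddr_eq0 ?frob2_ge0 ?bures_ge0 //.
case: g h gpd hpd => [m A] [m' B] /= gpd hpd.
by move=> /andP[/eqP/frob2_eq0/subr0_eq -> /eqP/(bures_eq0 gpd hpd) ->].
Qed.

Lemma W2sqC (R : realType) (n : nat) (g h : gaussian R n) :
  pd_mx (gcov g) -> pd_mx (gcov h) -> W2sq g h = W2sq h g.
Proof.
move=> gpd hpd; rewrite !W2sqE -frob2N opprB; congr (_ + _).
by apply/eqP; rewrite eq_le !bures_sym_le.
Qed.

Lemma W2sq_young (R : realType) (n : nat) (s : R) (g h k : gaussian R n) :
  pd_mx (gcov g) -> pd_mx (gcov h) -> pd_mx (gcov k) -> 0 < s ->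
  W2sq g k <= (1 + s) * W2sq g h + (1 + s^-1) * W2sq h k.
Proof.
move=> gpd hpd kpd s0; rewrite !W2sqE.
have := frob2_young (gmean g) (gmean h) (gmean k) s0.
have := bures_young gpd hpd kpd s0.
lra.
Qed.

(** * Couplings of mixtures *)

Lemma sumr_ge0_eq0 (R : numDomainType) (I : finType) (P : pred I) (F : I -> R) :
  (forall i, 0 <= F i) -> \sum_(i | P i) F i = 0 -> forall i, P i -> F i = 0.
Proof.
move=> F0 /eqP; rewrite psumr_eq0 // => /allP FE i Pi.
by apply/eqP; have := FE i (mem_index_enum i); rewrite Pi.
Qed.

Definition coupling_costs (R : realType) (n : nat) (mu0 mu1 : gmm R n) : set R :=
  [set c : R | exists P : 'M[R]_(gN mu0, gN mu1),
     coupling P /\ c = coupling_cost P]%classic.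

Lemma coupling_cost_ge0 (R : realType) (n : nat) (mu0 mu1 : gmm R n)
    (P : 'M[R]_(gN mu0, gN mu1)) :
  is_gmm mu0 -> is_gmm mu1 -> coupling P -> 0 <= coupling_cost P.
Proof.
move=> [_ _ pd0] [_ _ pd1] [P0 _ _]; apply: sumr_ge0 => i _.
by apply: sumr_ge0 => j _; rewrite mulr_ge0 ?W2sq_ge0.
Qed.

Lemma product_coupling (R : realType) (n : nat) (mu0 mu1 : gmm R n) :
  is_gmm mu0 -> is_gmm mu1 -> coupling (\matrix_(i, j) (gw mu0 i * gw mu1 j)).
Proof.
move=> [w0 s0 _] [w1 s1 _]; split => [i j|i|j].
- by rewrite mxE mulr_ge0.
- by under eq_bigr do rewrite mxE; rewrite -mulr_sumr s1 mulr1.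
- by under eq_bigr do rewrite mxE; rewrite -mulr_suml s0 mul1r.
Qed.

(** This makes [inf] a genuine infimum rather than a default value. *)
Lemma has_inf_coupling_costs (R : realType) (n : nat) (mu0 mu1 : gmm R n) :
  is_gmm mu0 -> is_gmm mu1 -> has_inf (coupling_costs mu0 mu1).
Proof.
move=> h0 h1; split.
  by eexists; eexists; split; first exact: product_coupling.
by exists 0 => _ [P [Pc ->]]; exact: coupling_cost_ge0.
Qed.

Lemma inf_coupling_costs_ge0 (R : realType) (n : nat) (mu0 mu1 : gmm R n) :
  is_gmm mu0 -> is_gmm mu1 -> 0 <= inf (coupling_costs mu0 mu1).
Proof.
move=> h0 h1; apply: lb_le_inf; first exact: (has_inf_coupling_costs h0 h1).1.
by move=> _ [P [Pc ->]]; exact: coupling_cost_ge0.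
Qed.

Lemma inf_coupling_costs_le (R : realType) (n : nat) (mu0 mu1 : gmm R n)
    (P : 'M[R]_(gN mu0, gN mu1)) : is_gmm mu0 -> is_gmm mu1 -> coupling P ->
  inf (coupling_costs mu0 mu1) <= coupling_cost P.
Proof.
move=> h0 h1 Pc; apply: ge_inf; first exact: (has_inf_coupling_costs h0 h1).2.
by exists P.
Qed.

(** [Num.sqrt] sends negative numbers to [0] as well, so the sign of the infimum matters. *)
Lemma gmm_dist_eq0 (R : realType) (n : nat) (mu0 mu1 : gmm R n) :
  is_gmm mu0 -> is_gmm mu1 ->
  gmm_dist mu0 mu1 = 0 <-> inf (coupling_costs mu0 mu1) = 0.
Proof.
move=> h0 h1; split=> [/eqP|dE]; last by rewrite /gmm_dist dE sqrtr0.
rewrite sqrtr_eq0 => d0; apply/eqP.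
by rewrite eq_le d0 inf_coupling_costs_ge0.
Qed.

Lemma coupling_costs_sub (R : realType) (n : nat) (mu0 mu1 : gmm R n) :
  is_gmm mu0 -> is_gmm mu1 ->
  (coupling_costs mu0 mu1 `<=` coupling_costs mu1 mu0)%classic.
Proof.
move=> [_ _ pd0] [_ _ pd1] _ [P [[P0 Pr Pc] ->]]; exists P^T; split.
  split=> [i j|i|j]; first by rewrite mxE.
    by under eq_bigr do rewrite mxE.
  by under eq_bigr do rewrite mxE.
rewrite /coupling_cost exchange_big; apply: eq_bigr => j _.
by apply: eq_bigr => i _; rewrite mxE W2sqC.
Qed.

Lemma gmm_distC (R : realType) (n : nat) (mu0 mu1 : gmm R n) :
  is_gmm mu0 -> is_gmm mu1 -> gmm_dist mu0 mu1 = gmm_dist mu1 mu0.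
Proof.
move=> h0 h1; rewrite /gmm_dist -!/(coupling_costs _ _).
by congr (Num.sqrt (inf _)); apply/seteqP; split; exact: coupling_costs_sub.
Qed.

(* The usual gluing: conditionally on the middle component [j], the outer ones
   are independent.  When [gw mu1 j = 0] the junk value of the division is
   harmless, since row and column [j] vanish. *)
Definition glue3 (R : realType) (n : nat) (mu0 mu1 mu2 : gmm R n)
    (P : 'M[R]_(gN mu0, gN mu1)) (Q : 'M[R]_(gN mu1, gN mu2)) i j k : R :=
  P i j * Q j k / gw mu1 j.

Lemma glue3_ge0 (R : realType) (n : nat) (mu0 mu1 mu2 : gmm R n)
    (P : 'M[R]_(gN mu0, gN mu1)) (Q : 'M[R]_(gN mu1, gN mu2)) i j k :
  coupling P -> coupling Q -> is_gmm mu1 -> 0 <= glue3 P Q i j k.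
Proof.
move=> [P0 _ _] [Q0 _ _] [w0 _ _].
by rewrite /glue3 divr_ge0 ?mulr_ge0.
Qed.

Lemma sum_glue3_right (R : realType) (n : nat) (mu0 mu1 mu2 : gmm R n)
    (P : 'M[R]_(gN mu0, gN mu1)) (Q : 'M[R]_(gN mu1, gN mu2)) i j :
  coupling P -> coupling Q -> \sum_k glue3 P Q i j k = P i j.
Proof.
move=> [P0 _ Pr] [_ Qr _]; rewrite /glue3 -mulr_suml -mulr_sumr Qr.
have [w0|w0] := eqVneq (gw mu1 j) 0; last by rewrite mulfK.
by rewrite w0 mulr0 mul0r (sumr_ge0_eq0 (P0^~ j) (etrans (Pr j) w0)).
Qed.

Lemma sum_glue3_left (R : realType) (n : nat) (mu0 mu1 mu2 : gmm R n)
    (P : 'M[R]_(gN mu0, gN mu1)) (Q : 'M[R]_(gN mu1, gN mu2)) j k :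
  coupling P -> coupling Q -> \sum_i glue3 P Q i j k = Q j k.
Proof.
move=> [_ _ Pr] [Q0 Qr _]; rewrite /glue3 -!mulr_suml Pr.
have [w0|w0] := eqVneq (gw mu1 j) 0; last by rewrite mulrAC divff ?mul1r.
by rewrite w0 invr0 mulr0 (sumr_ge0_eq0 (Q0 j) (etrans (Qr j) w0)).
Qed.

Lemma glue_coupling (R : realType) (n : nat) (mu0 mu1 mu2 : gmm R n)
    (P : 'M[R]_(gN mu0, gN mu1)) (Q : 'M[R]_(gN mu1, gN mu2)) :
  coupling P -> coupling Q -> is_gmm mu1 ->
  coupling (\matrix_(i, k) \sum_j glue3 P Q i j k : 'M[R]_(gN mu0, gN mu2)).
Proof.
move=> Pc Qc h1; split => [i k|i|k].
- by rewrite mxE sumr_ge0 // => j _; exact: glue3_ge0.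
- under eq_bigr do rewrite mxE.
  rewrite exchange_big; under eq_bigr do rewrite sum_glue3_right //.
  by case: Pc.
- under eq_bigr do rewrite mxE.
  rewrite exchange_big; under eq_bigr do rewrite sum_glue3_left //.
  by case: Qc.
Qed.

(** Summing out one index writes all three costs as sums over triples with the same weights [glue3];
    [W2sq_young] then applies term by term. *)
Lemma glue_cost_young (R : realType) (n : nat) (mu0 mu1 mu2 : gmm R n)
    (P : 'M[R]_(gN mu0, gN mu1)) (Q : 'M[R]_(gN mu1, gN mu2)) (s : R) :
  coupling P -> coupling Q ->
  is_gmm mu0 -> is_gmm mu1 -> is_gmm mu2 -> 0 < s ->
  coupling_cost (\matrix_(i, k) \sum_j glue3 P Q i j k : 'M[R]_(gN mu0, gN mu2))
  <= (1 + s) * coupling_cost P + (1 + s^-1) * coupling_cost Q.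
Proof.
move=> Pc Qc [_ _ pd0] h1 [_ _ pd2] s0; have [_ _ pd1] := h1.
pose c01 i j := W2sq (gcomp mu0 i) (gcomp mu1 j).
pose c12 j k := W2sq (gcomp mu1 j) (gcomp mu2 k).
have -> : coupling_cost P = \sum_i \sum_k \sum_j c01 i j * glue3 P Q i j k.
  apply: eq_bigr => i _; rewrite exchange_big; apply: eq_bigr => j _.
  by rewrite -mulr_sumr sum_glue3_right.
have -> : coupling_cost Q = \sum_i \sum_k \sum_j c12 j k * glue3 P Q i j k.
  rewrite /coupling_cost [LHS]exchange_big [RHS]exchange_big /=; apply: eq_bigr => k _.
  rewrite [RHS]exchange_big /=; apply: eq_bigr => j _.
  by rewrite -mulr_sumr sum_glue3_left.
rewrite !mulr_sumr -big_split ler_sum // => i _ /=.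
rewrite !mulr_sumr -big_split ler_sum // => k _ /=.
rewrite mxE !mulr_sumr -big_split ler_sum // => j _ /=.
move: (glue3 _ _ _ _ _) (glue3_ge0 i j k Pc Qc h1) => g g0.
rewrite !mulrA -mulrDl ler_wpM2r //.
exact: W2sq_young.
Qed.

Lemma inf_coupling_costs_young (R : realType) (n : nat) (s : R)
    (mu0 mu1 mu2 : gmm R n) :
  is_gmm mu0 -> is_gmm mu1 -> is_gmm mu2 -> 0 < s ->
  inf (coupling_costs mu0 mu2) <= (1 + s) * inf (coupling_costs mu0 mu1)
    + (1 + s^-1) * inf (coupling_costs mu1 mu2).
Proof.
move=> h0 h1 h2 s0.
have s1 : 0 < 1 + s by rewrite ltr_pwDl ?ltW.
have s2 : 0 < 1 + s^-1 by rewrite ltr_pwDl // invr_ge0 ltW.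
have [ne01 _] := has_inf_coupling_costs h0 h1.
have [ne12 _] := has_inf_coupling_costs h1 h2.
(* Each infimum is isolated in turn, so that the rest of the inequality becomes a lower bound of its
   set of costs. *)
rewrite -lerBlDr -ler_pdivrMl //; apply: (lb_le_inf ne01) => _ [P [Pc ->]].
rewrite ler_pdivrMl // lerBlDr -lerBlDl -ler_pdivrMl //.
apply: (lb_le_inf ne12) => _ [Q [Qc ->]]; rewrite ler_pdivrMl // lerBlDl.
apply: le_trans (inf_coupling_costs_le h0 h2 (glue_coupling Pc Qc h1)) _.
exact: glue_cost_young.
Qed.

(** For positive [x] and [y] the optimal [s] is [Num.sqrt y / Num.sqrt x], which makes the bound
    [(Num.sqrt x + Num.sqrt y) ^+ 2]. If one of them vanishes, the optimum is only approached as [s]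
    goes to infinity or to [0]. *)
Lemma sqrt_le_of_young (R : rcfType) (x y z : R) : 0 <= x -> 0 <= y ->
  (forall s, 0 < s -> z <= (1 + s) * x + (1 + s^-1) * y) ->
  Num.sqrt z <= Num.sqrt x + Num.sqrt y.
Proof.
move=> x0 y0 zs.
have [xy0|xy0] := eqVneq (Num.sqrt x + Num.sqrt y) 0.
  rewrite xy0; move/eqP: xy0; rewrite paddr_eq0 ?sqrtr_ge0 // !sqrtr_eq0.
  move=> /andP[x0' y0']; have xE : x = 0 by apply/eqP; rewrite eq_le x0' x0.
  have yE : y = 0 by apply/eqP; rewrite eq_le y0' y0.
  by have := zs 1 ltr01; rewrite xE yE !mulr0 addr0 -sqrtr_eq0 => /eqP ->.
have xyp : 0 < Num.sqrt x + Num.sqrt y.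
  by rewrite lt_neqAle eq_sym xy0 addr_ge0 ?sqrtr_ge0.
rewrite -(ger0_norm (ltW xyp)) -sqrtr_sqr ler_wsqrtr // sqrrD !sqr_sqrtr //.
have [xE|xn0] := eqVneq x 0.
  rewrite xE sqrtr0 mul0r mul0rn addr0 add0r.
  apply/ler_addgt0Pr => e e0.
  have y1 : 0 < y + 1 by rewrite ltr_wpDl.
  (* With this [s] the excess [s^-1 * y] is [e * y / (y + 1)], at most [e]. *)
  have s0 : 0 < (y + 1) / e by rewrite divr_gt0.
  have := zs _ s0; rewrite xE mulr0 add0r => /le_trans; apply.
  rewrite mulrDl mul1r lerD2l invf_div mulrAC ler_pdivrMr //.
  by rewrite ler_pM2l // lerDl ler01.
have [yE|yn0] := eqVneq y 0.
  rewrite yE sqrtr0 mulr0 mul0rn !addr0.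
  apply/ler_addgt0Pr => e e0.
  have x1 : 0 < x + 1 by rewrite ltr_wpDl.
  have s0 : 0 < e / (x + 1) by rewrite divr_gt0.
  have := zs _ s0; rewrite yE mulr0 addr0 => /le_trans; apply.
  rewrite mulrDl mul1r lerD2l mulrAC ler_pdivrMr //.
  by rewrite ler_pM2l // lerDl ler01.
have a0 : 0 < Num.sqrt x by rewrite sqrtr_gt0 lt_neqAle eq_sym xn0.
have b0 : 0 < Num.sqrt y by rewrite sqrtr_gt0 lt_neqAle eq_sym yn0.
have := zs _ (divr_gt0 b0 a0) => /le_trans; apply.
rewrite -{2}(sqr_sqrtr x0) -{3}(sqr_sqrtr y0) -{4}(sqr_sqrtr x0) -{5}(sqr_sqrtr y0).
rewrite le_eqVlt; apply/orP; left; apply/eqP; field.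
by rewrite !gt_eqF.
Qed.

Lemma gmm_dist_triangle (R : realType) (n : nat) (mu0 mu1 mu2 : gmm R n) :
  is_gmm mu0 -> is_gmm mu1 -> is_gmm mu2 ->
  gmm_dist mu0 mu2 <= gmm_dist mu0 mu1 + gmm_dist mu1 mu2.
Proof.
move=> h0 h1 h2; apply: sqrt_le_of_young; do ?exact: inf_coupling_costs_ge0.
by move=> s; exact: inf_coupling_costs_young.
Qed.

(** * Zero distance, equal densities and equal weights *)

Lemma gmm_dist0_density (R : realType) (n : nat) (mu0 mu1 : gmm R n) :
  is_gmm mu0 -> is_gmm mu1 -> gmm_dist mu0 mu1 = 0 ->
  mixture_density mu0 = mixture_density mu1.
Proof.
move=> h0 h1 /(gmm_dist_eq0 h0 h1) d0; apply/funext => x.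
have [_ _ pd0] := h0; have [_ _ pd1] := h1.
pose c i j := W2sq (gcomp mu0 i) (gcomp mu1 j).
pose e i j : R := `|gauss_density (gcomp mu0 i) x - gauss_density (gcomp mu1 j) x|.
(* [K] only has to dominate the finitely many ratios [e i j / c i j] with
   [c i j != 0], because [c i j = 0] forces equal components. *)
pose K : R := \sum_i \sum_j e i j / c i j.
have c0 i j : 0 <= c i j by exact: W2sq_ge0.
have r0 i j : 0 <= e i j / c i j by rewrite divr_ge0 ?normr_ge0.
have K0 : 0 <= K by apply: sumr_ge0 => i _; apply: sumr_ge0.
have eK i j : e i j <= K * c i j.
  have [cE|cn0] := eqVneq (c i j) 0.
    by rewrite /e (W2sq_eq0 (pd0 i) (pd1 j) cE) subrr normr0 mulr_ge0.
  rewrite -ler_pdivrMr ?lt_neqAle 1?eq_sym ?cn0 ?c0 //.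
  rewrite /K (bigD1 i) //= (bigD1 j) //= -addrA lerDl addr_ge0 //.
    exact: sumr_ge0.
  by apply: sumr_ge0 => k _; apply: sumr_ge0.
have le_cost (P : 'M[R]_(gN mu0, gN mu1)) : coupling P ->
    `|mixture_density mu0 x - mixture_density mu1 x| <= K * coupling_cost P.
  move=> [P0 Pr Pc].
  (* The marginals of [P] turn both mixture sums into sums over pairs. *)
  have -> : mixture_density mu0 x - mixture_density mu1 x = \sum_i \sum_j
      P i j * (gauss_density (gcomp mu0 i) x - gauss_density (gcomp mu1 j) x).
    under [RHS]eq_bigr do under eq_bigr do rewrite mulrBr.
    under [RHS]eq_bigr do rewrite sumrB.
    rewrite sumrB; congr (_ - _).
      by apply: eq_bigr => i _; rewrite -mulr_suml Pr.
    by rewrite exchange_big; apply: eq_bigr => j _; rewrite -mulr_suml Pc.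
  rewrite /coupling_cost !mulr_sumr.
  apply: le_trans (ler_norm_sum _ _ _) _; rewrite ler_sum // => i _.
  rewrite mulr_sumr; apply: le_trans (ler_norm_sum _ _ _) _.
  rewrite ler_sum // => j _; rewrite normrM ger0_norm // [K * _]mulrA mulrC.
  by rewrite ler_wpM2r //; exact: eK.
apply/eqP; rewrite -subr_eq0 -normr_le0.
(* If [K = 0], a single coupling already gives the bound [0]; otherwise dividing by [K] gives a
   lower bound of all costs, hence of their infimum. *)
have [KE|Kn0] := eqVneq K 0.
  by have := le_cost _ (product_coupling h0 h1); rewrite KE mul0r.
have Kp : 0 < K by rewrite lt_neqAle eq_sym Kn0.
rewrite -(mulr0 K) -ler_pdivrMl // mulrC -d0.
apply: lb_le_inf; first exact: (has_inf_coupling_costs h0 h1).1.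
by move=> _ [P [Pc ->]]; rewrite mulrC ler_pdivrMl // le_cost.
Qed.

(** A representation may repeat a Gaussian, so weights are compared per class of equal components.
    The coupling is the product coupling inside each class, normalised by its weight [w]; a class of
    weight [0] has only zero weights. *)
Lemma same_weights_dist0 (R : realType) (n : nat) (mu0 mu1 : gmm R n) :
  is_gmm mu0 -> is_gmm mu1 ->
  (forall g, \sum_(i | `[< gcomp mu0 i = g >]) gw mu0 i =
             \sum_(j | `[< gcomp mu1 j = g >]) gw mu1 j) ->
  gmm_dist mu0 mu1 = 0.
Proof.
move=> h0 h1 ww; have [p0 _ pd0] := h0; have [p1 _ pd1] := h1.
pose w g := \sum_(i | `[< gcomp mu0 i = g >]) gw mu0 i.
pose P : 'M[R]_(gN mu0, gN mu1) := \matrix_(i, j)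
  if `[< gcomp mu0 i = gcomp mu1 j >]
  then gw mu0 i * gw mu1 j / w (gcomp mu0 i) else 0.
have w0 g : 0 <= w g by exact: sumr_ge0.
have Pc : coupling P.
  split => [i j|i|j].
  - by rewrite mxE; case: ifP => // _; rewrite divr_ge0 ?mulr_ge0.
  - under eq_bigr do rewrite mxE; rewrite -big_mkcond /= -mulr_suml -mulr_sumr.
    have -> : \sum_(j | `[< gcomp mu0 i = gcomp mu1 j >]) gw mu1 j = w (gcomp mu0 i).
      by rewrite /w ww; apply: eq_bigl => j; apply/asboolP/asboolP.
    have [wE|wn0] := eqVneq (w (gcomp mu0 i)) 0; last by rewrite mulfK.
    by rewrite wE mulr0 mul0r (sumr_ge0_eq0 p0 wE) //; apply/asboolP.
  - under eq_bigr do rewrite mxE; rewrite -big_mkcond /=.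
    under eq_bigr => i /asboolP-> do rewrite mulrAC.
    rewrite -!mulr_suml -/(w _).
    have [wE|wn0] := eqVneq (w (gcomp mu1 j)) 0; last by rewrite divff // mul1r.
    rewrite wE !mul0r; apply/esym.
    by move: wE; rewrite /w ww => /(sumr_ge0_eq0 p1); apply; apply/asboolP.
apply/(gmm_dist_eq0 h0 h1)/eqP.
rewrite eq_le inf_coupling_costs_ge0 // andbT.
suff <- : coupling_cost P = 0 by exact: inf_coupling_costs_le.
rewrite /coupling_cost big1 // => i _; rewrite big1 // => j _; rewrite mxE.
case: asboolP => [<-|_]; last by rewrite mulr0.
by rewrite W2sq_refl // mul0r.
Qed.

(** * Linear independence of Gaussian densities *)

(** Orders the pairs [(a, b)] by the growth of [expR (a * t ^+ 2 + b * t)] for large [t]. *)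
Definition lex_lt (R : realType) (p q : R * R) : Prop :=
  p.1 < q.1 \/ p.1 = q.1 /\ p.2 < q.2.

Lemma quadratic_to_ninfty (R : realType) (a b M : R) : lex_lt (a, b) (0, 0) ->
  exists T, forall t, T <= t -> a * t ^+ 2 + b * t <= - M.
Proof.
case=> /= [a0|[-> b0]]; last first.
  exists (- M / b) => t tT; rewrite mul0r add0r.
  by rewrite -[- M](divfK (ltr0_neq0 b0)) mulrC ler_nM2r.
(* This ensures [1 <= t] and [a * t + b <= - |M|], and the product of [t] with the latter is at most
   [- M]. *)
exists (1 + (`|b| + `|M|) / - a) => t tT.
have na : 0 < - a by rewrite oppr_gt0.
have r0 : 0 <= (`|b| + `|M|) / - a.
  by rewrite divr_ge0 ?addr_ge0 ?normr_ge0 ?ltW.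
have t1 : 1 <= t by apply: le_trans tT; rewrite lerDl.
have at_ : `|b| + `|M| <= t * - a.
  by rewrite -ler_pdivrMr // (le_trans _ tT) // lerDr.
have bb := ler_norm b; have MM := ler_norm M; have M0 := normr_ge0 M.
nra.
Qed.

Lemma expR_quadratic_small (R : realType) (a b e : R) :
  lex_lt (a, b) (0, 0) -> 0 < e ->
  exists T, forall t, T <= t -> expR (a * t ^+ 2 + b * t) <= e.
Proof.
(* The level [e^-1] works because [expR e^-1 >= 1 + e^-1 >= e^-1]. *)
move=> /quadratic_to_ninfty-/(_ e^-1)[T qT] e0; exists T => t /qT qt.
apply: le_trans (_ : expR (- e^-1) <= e); first by rewrite ler_expR.
rewrite expRN invf_ple ?posrE ?expR_gt0 //.
by apply: le_trans (expR_ge1Dx _); rewrite lerDr.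
Qed.

Lemma sum_expR_quadratic_small (R : realType) (s : seq (R * R)) (C : R * R -> R)
    (p0 : R * R) (e : R) : {in s, forall p, lex_lt p p0} -> 0 < e ->
  exists T, forall t, T <= t ->
    `|\sum_(p <- s) C p * expR ((p.1 - p0.1) * t ^+ 2 + (p.2 - p0.2) * t)| <= e.
Proof.
elim: s e => [|p s IH] e sp e0.
  by exists 0 => t _; rewrite big_nil normr0 ltW.
have e2 : 0 < e / 2 by rewrite divr_gt0.
have [|T1 T1P] := IH _ _ e2.
  by move=> q qs; apply: sp; rewrite inE qs orbT.
have C1 : 0 < 1 + `|C p| by rewrite ltr_pwDl.
(* The added [1] keeps the denominator positive when [C p = 0]. *)
have [||T2 T2P] := @expR_quadratic_small _ (p.1 - p0.1) (p.2 - p0.2)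
    (e / 2 / (1 + `|C p|)).
- have := sp p (mem_head _ _); rewrite /lex_lt /= !subr_lt0.
  by case=> [|[-> ?]]; [left|right; rewrite subrr].
- by rewrite divr_gt0.
exists (Num.max T1 T2) => t; rewrite ge_max => /andP[/T1P t1 /T2P t2].
rewrite big_cons (le_trans (ler_normD _ _)) // [leRHS](splitr e) lerD //.
rewrite normrM (ger0_norm (expR_ge0 _)).
rewrite ler_pdivlMr // in t2; apply: le_trans t2.
by rewrite mulrC ler_wpM2l ?expR_ge0 // lerDr.
Qed.

Lemma lex_max (R : realType) (p : R * R) (s : seq (R * R)) :
  exists2 p0, p0 \in p :: s &
    {in p :: s, forall q, q != p0 -> lex_lt q p0}.
Proof.
elim: s p => [p|q s IH p].
  by exists p; rewrite ?mem_head // => q; rewrite inE => /eqP->; rewrite eqxx.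
have [m ms mP] := IH q.
have [->|pm] := eqVneq p m.
  exists m; first by rewrite mem_head.
  by move=> r; rewrite inE => /predU1P[->|/mP//]; rewrite eqxx.
have [pltm|mltp] : lex_lt p m \/ lex_lt m p.
  case: (ltgtP p.1 m.1) => [h|h|h]; first by left; left.
    by right; left.
  case: (ltgtP p.2 m.2) => [h'|h'|h'].
  - by left; right.
  - by right; right.
  - by move: pm; rewrite [p]surjective_pairing h h' -surjective_pairing eqxx.
  exists m; first by rewrite inE ms orbT.
  by move=> r; rewrite inE => /predU1P[-> //|/mP].
exists p; first by rewrite mem_head.
move=> r; rewrite inE => /predU1P[->|rs]; first by rewrite eqxx.
have [-> //|/(mP _ rs) rm _] := eqVneq r m.
move: rm mltp; rewrite /lex_lt => -[rm|[-> rm]] [mp|[<- mp]].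
- by left; exact: lt_trans mp.
- by left.
- by left.
- by right; split => //; exact: lt_trans mp.
Qed.

(** Divided by the dominant exponential, the relation reads [C m] plus terms tending to [0], so
    [C m = 0]. Then [m] is removed; it need not be the head, hence the induction on the size. *)
Lemma expR_quadratic_indep (R : realType) (s : seq (R * R)) (C : R * R -> R) :
  uniq s ->
  (forall t, \sum_(p <- s) C p * expR (p.1 * t ^+ 2 + p.2 * t) = 0) ->
  {in s, forall p, C p = 0}.
Proof.
have [k] := ubnP (size s); elim: k s => // k IH [|p s] // ks us s0.
have [m ms mP] := lex_max p s; move: (p :: s) ks us s0 ms mP => {p}s ks us s0 ms mP.
have srem := perm_to_rem ms.
have s0' t : C m * expR (m.1 * t ^+ 2 + m.2 * t) +
    \sum_(p <- rem m s) C p * expR (p.1 * t ^+ 2 + p.2 * t) = 0.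
  by have := s0 t; rewrite (perm_big _ srem) big_cons.
have remP : {in rem m s, forall p, lex_lt p m}.
  by move=> q; rewrite mem_rem_uniq // inE => /andP[qm /mP]; apply.
have Cm : C m = 0.
  apply/eqP/negPn/negP => Cm0.
  have e0 : 0 < `|C m| / 2 by rewrite divr_gt0 ?normr_gt0.
  have [T /(_ T (lexx _))] := sum_expR_quadratic_small C remP e0.
  have -> : \sum_(p <- rem m s)
      C p * expR ((p.1 - m.1) * T ^+ 2 + (p.2 - m.2) * T) = - C m.
    apply/eqP; rewrite -addr_eq0 addrC; apply/eqP.
    have := s0' T => /(congr1 ( *%R^~ (expR (- (m.1 * T ^+ 2 + m.2 * T))))).
    rewrite mul0r mulrDl -mulrA -expRD subrr expR0 mulr1 mulr_suml => E; rewrite -[RHS]E.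
    congr (_ + _); apply: eq_bigr => q _; rewrite -mulrA -expRD.
    by congr (_ * expR _); ring.
  rewrite normrN; have := Cm0; rewrite -normr_gt0; lra.
move=> q; have [-> //|qm qs] := eqVneq q m.
apply: (IH (rem m s)).
- by rewrite size_rem //; case: (s) ms ks.
- exact: rem_uniq.
- by move=> t; have := s0' t; rewrite Cm mul0r add0r.
- by rewrite mem_rem_uniq // inE qm.
Qed.

(** * Generic directions avoiding finitely many zero sets *)

Definition polynomial_on_lines (R : realType) (n : nat) (h : 'rV[R]_n -> R) :=
  forall v w, exists p : {poly R}, forall x, h (v + x *: w) = p.[x].

Lemma polynomial_on_lines_prod (R : realType) (n : nat) (I : eqType) (s : seq I)
    (h : I -> 'rV[R]_n -> R) :
  {in s, forall i, polynomial_on_lines (h i)} ->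
  polynomial_on_lines (fun v => \prod_(i <- s) h i v).
Proof.
elim: s => [_ v w|i s IH hs v w].
  by exists 1 => x; rewrite big_nil hornerE.
have [|p pE] := IH _ v w; first by move=> j js; apply: hs; rewrite inE js orbT.
have [q qE] := hs i (mem_head _ _) v w.
by exists (q * p) => x; rewrite big_cons hornerM qE pE.
Qed.

(** The [size p] distinct integers tested are more than the roots [p] can have. *)
Lemma poly_nonroot (R : numDomainType) (p : {poly R}) :
  p != 0 -> exists x, p.[x] != 0.
Proof.
move=> p0; pose s := [seq (i%:R : R) | i <- iota 0 (size p)].
have us : uniq s.
  by rewrite map_inj_uniq ?iota_uniq //; apply: mulrIn; rewrite oner_eq0.
have [/(max_poly_roots p0)/(_ us)|/allPn[x _ px]] := boolP (all (root p) s).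
  by rewrite size_map size_iota ltnn.
by exists x.
Qed.

(** Join a point [v] good for the tail to a point [w] good for the head. On this line both
    restrictions are nonzero polynomials, seen at the parameters [0] and [1], so their product has a
    nonroot. *)
Lemma polynomial_on_lines_nonzero (R : realType) (n : nat) (I : eqType)
    (s : seq I) (h : I -> 'rV[R]_n -> R) :
  {in s, forall i, polynomial_on_lines (h i)} ->
  {in s, forall i, exists v, h i v != 0} ->
  exists v, {in s, forall i, h i v != 0}.
Proof.
elim: s => [_ _|i s IH hs h0]; first by exists 0.
have hs' : {in s, forall j, polynomial_on_lines (h j)}.
  by move=> j js; apply: hs; rewrite inE js orbT.
have [|v vs] := IH hs'; first by move=> j js; apply: h0; rewrite inE js orbT.
have [w hw] := h0 i (mem_head _ _).
have [p pE] := polynomial_on_lines_prod hs' v (w - v).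
have [q qE] := hs i (mem_head _ _) v (w - v).
have pn0 : p != 0.
  apply/negP => /eqP p0; have := pE 0; rewrite p0 horner0 scale0r addr0 => /eqP.
  by rewrite prodf_seq_eq0 => /hasP[j js /=]; rewrite (negPf (vs j js)).
have qn0 : q != 0.
  apply/negP => /eqP q0; have := qE 1; rewrite q0 horner0 scale1r subrKC => /eqP.
  by rewrite (negPf hw).
have [x] := poly_nonroot (mulf_neq0 qn0 pn0).
rewrite hornerM mulf_eq0 negb_or -pE -qE => /andP[hx hsx].
exists (v + x *: (w - v)) => j; rewrite inE => /predU1P[-> //|js].
by move: hsx; rewrite prodf_seq_eq0 => /hasPn/(_ j js).
Qed.

Definition quadlin (R : realType) (n : nat) (Q : 'M[R]_n) (b : 'cV[R]_n)
    (v : 'rV[R]_n) : R := (v *m Q *m v^T) 0 0 + (v *m b) 0 0.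

Lemma quadlin_polynomial (R : realType) (n : nat) (Q : 'M[R]_n) (b : 'cV[R]_n) :
  polynomial_on_lines (quadlin Q b).
Proof.
move=> v w; exists ((quadlin Q b v)%:P
  + ((v *m Q *m w^T) 0 0 + (w *m Q *m v^T) 0 0 + (w *m b) 0 0) *: 'X
  + ((w *m Q *m w^T) 0 0) *: 'X^2) => x.
rewrite !hornerE /quadlin linearD linearZ /= !mulmxDl !mulmxDr -!scalemxAl -!scalemxAr.
rewrite !mxE; ring.
Qed.

(** If the function vanished identically, its values at [v] and [- v] would separate the two parts;
    unit vectors then give [b = 0], and polarisation gives [Q = 0]. *)
Lemma quadlin_nonzero (R : realType) (n : nat) (Q : 'M[R]_n) (b : 'cV[R]_n) :
  Q^T = Q -> Q != 0 \/ b != 0 -> exists v, quadlin Q b v != 0.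
Proof.
move=> Qs Qb; apply: contrapT => /forallNP h0.
have {}h0 v : quadlin Q b v = 0 by apply/eqP/negPn/negP; exact: h0.
have q0 (v : 'rV[R]_n) : (v *m Q *m v^T) 0 0 = 0.
  have := h0 v; have := h0 (- v); rewrite /quadlin linearN /= !mulNmx mulmxN opprK.
  rewrite [(- (v *m b)) 0 0]mxE; lra.
have b0 : b = 0.
  apply/colP => i; have := h0 (delta_mx 0 i).
  by rewrite /quadlin q0 add0r -rowE mxE => ->; rewrite mxE.
have Q0 : Q = 0.
  apply/matrixP => i j; have := q0 (delta_mx 0 i + delta_mx 0 j).
  have := q0 (delta_mx 0 i); have := q0 (delta_mx 0 j).
  have dE k l : (delta_mx 0 k *m Q *m (delta_mx 0 l)^T : 'M[R]_1) 0 0 = Q k l.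
    by rewrite trmx_delta -rowE -colE !mxE.
  have addE (X Y : 'M[R]_1) : (X + Y) 0 0 = X 0 0 + Y 0 0 by rewrite mxE.
  rewrite linearD /= !mulmxDl !mulmxDr !addE !dE.
  have : Q j i = Q i j by rewrite -{1}Qs mxE.
  rewrite mxE; lra.
by case: Qb; rewrite ?Q0 ?b0 eqxx.
Qed.

(** The value of the density at the origin. *)
Definition gauss_const (R : realType) (n : nat) (g : gaussian R n) : R :=
  expR (- (gmean g *m invmx (gcov g) *m (gmean g)^T) 0 0 / 2)
  / Num.sqrt ((2 * pi) ^+ n * \det (gcov g)).

(** The coefficients of [t ^+ 2] and [t] in the exponent of the density at [t *: v]. *)
Definition line_coefs (R : realType) (n : nat) (v : 'rV[R]_n)
    (g : gaussian R n) : R * R :=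
  (- (v *m invmx (gcov g) *m v^T) 0 0 / 2,
   (v *m invmx (gcov g) *m (gmean g)^T) 0 0).

Lemma invmx_sym (R : realType) (n : nat) (A : 'M[R]_n) :
  pd_mx A -> (invmx A)^T = invmx A.
Proof. by move=> [As _]; rewrite trmx_inv As. Qed.

Lemma pd_det_gt0 (R : realType) (n : nat) (A : 'M[R]_n) :
  pd_mx A -> 0 < \det A.
Proof.
move=> Apd; have [X XA] := pd_factor Apd.
have := pd_unit Apd; rewrite unitmxE unitfE => dA.
by rewrite lt_neqAle eq_sym dA -XA det_mulmx det_tr -expr2 sqr_ge0.
Qed.

Lemma gauss_const_gt0 (R : realType) (n : nat) (g : gaussian R n) :
  pd_mx (gcov g) -> 0 < gauss_const g.
Proof.
move=> gpd; rewrite /gauss_const divr_gt0 ?expR_gt0 // sqrtr_gt0 mulr_gt0 //.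
  by rewrite exprn_gt0 // mulr_gt0 // pi_gt0.
exact: pd_det_gt0.
Qed.

Lemma gauss_density_line (R : realType) (n : nat) (g : gaussian R n)
    (v : 'rV[R]_n) (t : R) : pd_mx (gcov g) ->
  gauss_density g (t *: v) = gauss_const g *
    expR ((line_coefs v g).1 * t ^+ 2 + (line_coefs v g).2 * t).
Proof.
move=> gpd; rewrite /gauss_density /gauss_const /line_coefs /= mulrAC -expRD.
congr (expR _ / _); set S := invmx _; set m := gmean g.
have mSv : (m *m S *m v^T) 0 0 = (v *m S *m m^T) 0 0.
  have -> : m *m S *m v^T = (v *m S *m m^T)^T.
    by rewrite !trmx_mul trmxK invmx_sym // mulmxA.
  by rewrite mxE.
have addE (X Y : 'M[R]_1) : (X + Y) 0 0 = X 0 0 + Y 0 0 by rewrite mxE.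
have oppE (X : 'M[R]_1) : (- X) 0 0 = - X 0 0 by rewrite mxE.
have sclE a (X : 'M[R]_1) : (a *: X) 0 0 = a * X 0 0 by rewrite mxE.
rewrite linearB linearZ /= !mulmxBl !mulmxBr -!scalemxAl -!scalemxAr.
rewrite !(addE, oppE, sclE) mSv; by field.
Qed.

(** For each pair of distinct Gaussians, [v] must avoid the zero set of one function [quadlin],
    built from the differences of the inverse covariances and of their products with the means. *)
Lemma line_coefs_separate (R : realType) (n : nat) (I : finType)
    (G : I -> gaussian R n) : (forall i, pd_mx (gcov (G i))) ->
  exists v, forall i j, line_coefs v (G i) = line_coefs v (G j) -> G i = G j.
Proof.
move=> pdG; pose s := [seq ij <- enum {: I * I} | `[< G ij.1 <> G ij.2 >]].
pose Q (ij : I * I) := invmx (gcov (G ij.1)) - invmx (gcov (G ij.2)).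
pose b (ij : I * I) := invmx (gcov (G ij.1)) *m (gmean (G ij.1))^T
                       - invmx (gcov (G ij.2)) *m (gmean (G ij.2))^T.
have [||v vP] := @polynomial_on_lines_nonzero _ _ _ s (fun ij => quadlin (Q ij) (b ij)).
- by move=> ij _; exact: quadlin_polynomial.
- move=> ij; rewrite mem_filter => /andP[/asboolP GG _]; apply: quadlin_nonzero.
    by rewrite linearB /= !invmx_sym.
  apply/orP; rewrite -negb_and; apply/negP => /andP[]; rewrite !subr_eq0.
  move=> /eqP SS /eqP; rewrite -SS => bb; apply: GG.
  have cc : gcov (G ij.1) = gcov (G ij.2).
    by rewrite -[LHS]invmxK SS invmxK.
  have /trmx_inj mm : (gmean (G ij.1))^T = (gmean (G ij.2))^T.
    have := congr1 (mulmx (gcov (G ij.1))) bb.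
    by rewrite !mulKVmx ?pd_unit.
  by case: (G ij.1) (G ij.2) cc mm => [? ?] [? ?] /= -> ->.
exists v => i j [vv bb]; apply: contrapT => GG.
have /vP/eqP : (i, j) \in s by rewrite mem_filter mem_enum andbT; apply/asboolP.
(* Equal coefficients make the quadratic and the linear summand vanish separately. *)
apply; rewrite /quadlin /Q /b /= !mulmxBr mulmxBl !mulmxA.
have subE (X Y : 'M[R]_1) : (X - Y) 0 0 = X 0 0 - Y 0 0 by rewrite !mxE.
by rewrite !subE bb; move: vv; lra.
Qed.

(** [G] may take a value several times, so only the total coefficient of each Gaussian is
    determined. On a separating line the terms group by exponent, one group per Gaussian. *)
Lemma gauss_density_indep (R : realType) (n : nat) (I : finType)
    (G : I -> gaussian R n) (c : I -> R) : (forall i, pd_mx (gcov (G i))) ->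
  (forall x, \sum_i c i * gauss_density (G i) x = 0) ->
  forall g, \sum_(i | `[< G i = g >]) c i = 0.
Proof.
move=> pdG cG g; have [v vP] := line_coefs_separate pdG.
pose f i := line_coefs v (G i).
pose C p := \sum_(i | f i == p) c i * gauss_const (G i).
have C0 : {in undup [seq f i | i <- index_enum I], forall p, C p = 0}.
  apply: expR_quadratic_indep; first exact: undup_uniq.
  move=> t; rewrite -[RHS](cG (t *: v)).
  under eq_bigr do rewrite mulr_suml.
  rewrite (exchange_big_dep predT) //=; apply: eq_bigr => i _.
  rewrite gauss_density_line // -/(f i) mulrA.
  rewrite big_mkcond (bigD1_seq (f i)) ?undup_uniq ?mem_undup ?map_f ?mem_index_enum //=.
  by rewrite eqxx big1 ?addr0 // => p; rewrite eq_sym => /negPf ->.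
have [[i0 Gi0]|noi] := pselect (exists i, G i = g); last first.
  by rewrite big1 // => i /asboolP Gi; case: noi; exists i.
have := C0 (f i0); rewrite mem_undup map_f ?mem_index_enum // => /(_ isT).
have -> : C (f i0) = gauss_const g * \sum_(i | `[< G i = g >]) c i.
  rewrite mulr_sumr /C; apply: eq_big => [i|i /eqP/vP ->].
    by apply/eqP/asboolP => [/vP ->|Gi] //; rewrite /f Gi Gi0.
  by rewrite Gi0 mulrC.
move=> /eqP; rewrite mulf_eq0 gt_eqF ?orFb ?gauss_const_gt0 // -?Gi0 //.
by move=> /eqP.
Qed.

(** Linear independence is applied to the disjoint union of the two families, with the second
    weights negated. *)
Lemma density_gmm_dist0 (R : realType) (n : nat) (mu0 mu1 : gmm R n) :
  is_gmm mu0 -> is_gmm mu1 -> mixture_density mu0 = mixture_density mu1 ->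
  gmm_dist mu0 mu1 = 0.
Proof.
move=> h0 h1 dd; have [_ _ pd0] := h0; have [_ _ pd1] := h1.
apply: same_weights_dist0 => // g.
pose G (i : 'I_(gN mu0) + 'I_(gN mu1)) :=
  match i with inl i => gcomp mu0 i | inr j => gcomp mu1 j end.
pose c (i : 'I_(gN mu0) + 'I_(gN mu1)) :=
  match i with inl i => gw mu0 i | inr j => - gw mu1 j end.
have : \sum_(i | `[< G i = g >]) c i = 0.
  apply: gauss_density_indep => [[]//|x]; rewrite big_sumType /=.
  under [X in _ + X]eq_bigr do rewrite mulNr.
  rewrite sumrN; apply/eqP; rewrite subr_eq0; apply/eqP.
  by change (mixture_density mu0 x = mixture_density mu1 x); rewrite dd.
by rewrite big_sumType /= sumrN => /eqP; rewrite subr_eq0 => /eqP.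
Qed.

Theorem theorem1 (R : realType) (n : nat) (mu0 mu1 mu2 : gmm R n) :
  is_gmm mu0 -> is_gmm mu1 -> is_gmm mu2 ->
  [/\ 0 <= gmm_dist mu0 mu1,
      gmm_dist mu0 mu1 = 0 <-> mixture_density mu0 = mixture_density mu1,
      gmm_dist mu0 mu1 = gmm_dist mu1 mu0
    & gmm_dist mu0 mu2 <= gmm_dist mu0 mu1 + gmm_dist mu1 mu2].
Proof.
move=> h0 h1 h2; split.
- exact: sqrtr_ge0.
- by split; [exact: gmm_dist0_density | exact: density_gmm_dist0].
- exact: gmm_distC.
- exact: gmm_dist_triangle.
Qed.
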